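(* Let $f$ be a smooth real function of one variable and let $g_{\alpha\beta}$ be the Robertson–Walker metric $$ds^2=-dt^2+a^2(t)\left[\frac{dr^2}{1-kr^2}+r^2d\theta^2+r^2\sin^2\theta\,d\varphi^2\right],$$ with $a(t)>0$ smooth and $k\in\{-1,0,1\}$. Let $T_{\alpha\beta}=(\rho+p)u_\alpha u_\beta+p\,g_{\alpha\beta}$, where $u^\alpha=(\partial_t)^\alpha$ and $\rho=\rho(t)$, $p=p(t)$. Suppose that $f'(R)\neq0$ and that the $f(R)$ field equations $$f'(R)R_{\alpha\beta}-\tfrac12 f(R)g_{\alpha\beta}+g_{\alpha\beta}\square f'(R)-\nabla_\alpha\nabla_\beta f'(R)=\kappa T_{\alpha\beta}$$ hold. Put $H=\dot a/a$. Then: 1. For every vector $\eta^\alpha$ with $\eta_\alpha u^\alpha=0$, $$R^{\alpha}{}_{\beta\gamma\delta}\,u^\beta\eta^\gamma u^\delta=\frac{1}{2f'(R)}\left[\frac{2\kappa\rho}{3}-\frac{f(R)}{3}-2Hf''(R)\dot R\right]\eta^\alpha .$$ 2. If $\eta^\alpha=\ell e^\alpha$ is a deviation vector along an integral curve of $u^\alpha$, i.e. $\frac{D^2\eta^\alpha}{Dt^2}=-R^{\alpha}{}_{\beta\gamma\delta}u^\beta\eta^\gamma u^\delta$, where $e_\alpha e^\alpha=1$, $e_\alpha u^\alpha=0$ and $\frac{De^\alpha}{Dt}=0$, then $$\frac{d^2\ell}{dt^2}=-\frac{1}{2f'(R)}\left[\frac{2\kappa\rho}{3}-\frac{f(R)}{3}-2Hf''(R)\dot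 R\right]\ell .$$ 3. In particular (the case $\ell=a$), the generalized Raychaudhuri equation holds: $$\frac{\ddot a}{a}=\frac{1}{f'(R)}\left[\frac{f(R)}{6}+Hf''(R)\dot R-\frac{\kappa\rho}{3}\right].$$
   Context: Conventions: $\kappa=8\pi G>0$ is a constant, the signature is $(-,+,+,+)$, and the connection is Levi-Civita. The Riemann tensor is $R^{\alpha}{}_{\beta\gamma\delta}=\partial_\gamma\Gamma^\alpha_{\delta\beta}-\partial_\delta\Gamma^\alpha_{\gamma\beta}+\Gamma^\alpha_{\gamma\sigma}\Gamma^\sigma_{\delta\beta}-\Gamma^\alpha_{\sigma\delta}\Gamma^\sigma_{\gamma\beta}$, the Ricci tensor is $R_{\alpha\beta}=R^{\eta}{}_{\alpha\eta\beta}$, and $R=g^{\alpha\beta}R_{\alpha\beta}$. Primes on $f$ are derivatives with respect to $R$, dots are derivatives with respect to $t$, and $\square=\nabla^\sigma\nabla_\sigma$. The integral curves of $u^\alpha=(\partial_t)^\alpha$ (the fundamental observers) are timelike geodesics with proper time $t$, and $\frac{D}{Dt}=u^\beta\nabla_\beta$ is the covariant derivative along them. *)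

(* Defs.v *)
From Stdlib Require Import Reals Lra.
From Coquelicot Require Import Coquelicot.
Open Scope R_scope.

Inductive coord : Set := ct | cr | cth | cph.

Definition coord_eq_dec (m n : coord) : {m = n} + {m <> n}.
Proof. decide equality. Defined.

Definition point := coord -> R.
Definition vector := coord -> R.
Definition tensor2 := point -> coord -> coord -> R.

Definition sum4 (F : coord -> R) : R := F ct + F cr + F cth + F cph.

Definition delta (al be : coord) : R := if coord_eq_dec al be then 1 else 0.

Definition upd (x : point) (m : coord) (s : R) : point :=
  fun n => if coord_eq_dec n m then s else x n.

Definition pd (m : coord) (F : point -> R) (x : point) : R :=
  Derive (fun s => F (upd x m s)) (x m).

Definition diff_on (n : nat) (D : R -> Prop) (h : R -> R) : Prop :=
  forall m x, (m <= n)%nat -> D x -> ex_derive_n h m x.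

Definition smooth_on (D : R -> Prop) (h : R -> R) : Prop :=
  forall n, diff_on n D h.

(* A metric in the coordinate domain U, together with its inverse.  The values
   of the components outside U are irrelevant. *)
Record metric (U : point -> Prop) := Metric {
  gdn : tensor2;
  gup : tensor2;
  gdn_sym : forall x, U x -> forall al be, gdn x al be = gdn x be al;
  gup_gdn : forall x, U x -> forall al be,
    sum4 (fun s => gup x al s * gdn x s be) = delta al be }.

Arguments gdn {U} _ _ _ _.
Arguments gup {U} _ _ _ _.

Section Geometry.

Context {U : point -> Prop} (g : metric U).

Definition inner (x : point) (v w : vector) : R :=
  sum4 (fun al => sum4 (fun be => gdn g x al be * v al * w be)).

Definition lower (x : point) (v : vector) (al : coord) : R :=
  sum4 (fun be => gdn g x al be * v be).

(* Gamma^al_{be ga} *)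
Definition christoffel (x : point) (al be ga : coord) : R :=
  / 2 * sum4 (fun s => gup g x al s *
    (pd be (fun y => gdn g y s ga) x
     + pd ga (fun y => gdn g y s be) x
     - pd s (fun y => gdn g y be ga) x)).

(* R^al_{be ga de} *)
Definition riemann (x : point) (al be ga de : coord) : R :=
  pd ga (fun y => christoffel y al de be) x
  - pd de (fun y => christoffel y al ga be) x
  + sum4 (fun s => christoffel x al ga s * christoffel x s de be)
  - sum4 (fun s => christoffel x al s de * christoffel x s ga be).

Definition ricci (x : point) (al be : coord) : R :=
  sum4 (fun e => riemann x e al e be).

Definition scalar_curvature (x : point) : R :=
  sum4 (fun al => sum4 (fun be => gup g x al be * ricci x al be)).

(* nabla_al w_be, for a covector field w *)
Definition nabla_covector (w : point -> coord -> R) (x : point)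
    (al be : coord) : R :=
  pd al (fun y => w y be) x - sum4 (fun s => christoffel x s al be * w x s).

(* nabla_al nabla_be F, for a scalar field F *)
Definition hessian (F : point -> R) (x : point) (al be : coord) : R :=
  nabla_covector (fun y m => pd m F y) x al be.

Definition box (F : point -> R) (x : point) : R :=
  sum4 (fun s => sum4 (fun t => gup g x s t * hessian F x t s)).

(* R^al_{be ga de} v^be eta^ga v^de *)
Definition tidal (x : point) (v eta : vector) (al : coord) : R :=
  sum4 (fun be => sum4 (fun ga => sum4 (fun de =>
    riemann x al be ga de * v be * eta ga * v de))).

(* The covariant derivative, along the curve c, of a vector field V along c;
   V s is a tangent vector at the point c s. *)
Definition cov_along (c : R -> point) (V : R -> vector) (s : R) : vector :=
  fun al => Derive (fun z => V z al) s
    + sum4 (fun be => sum4 (fun ga =>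
        christoffel (c s) al be ga * Derive (fun z => c z be) s * V s ga)).

(* c, restricted to the parameter values in S, is an integral curve of v
   contained in the coordinate domain. *)
Definition integral_curve (S : R -> Prop) (v : point -> vector)
    (c : R -> point) : Prop :=
  forall s, S s ->
    U (c s) /\ forall al, is_derive (fun z => c z al) s (v (c s) al).

Definition deviation_vector (S : R -> Prop) (v : point -> vector)
    (c : R -> point) (eta : R -> vector) : Prop :=
  forall s, S s -> forall al,
    cov_along c (cov_along c eta) s al = - tidal (c s) (v (c s)) (eta s) al.

Definition fR_field_equations (f : R -> R) (kappa : R) (T : tensor2) : Prop :=
  let F := fun y => Derive f (scalar_curvature y) in
  forall x, U x -> forall al be,
    F x * ricci x al be
    - / 2 * f (scalar_curvature x) * gdn g x al be
    + gdn g x al be * box F x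
    - hessian F x al be
    = kappa * T x al be.

(* The components of T with both indices down; rho and p depend on t only. *)
Definition perfect_fluid (u : point -> vector) (rho p : R -> R) : tensor2 :=
  fun x al be =>
    (rho (x ct) + p (x ct)) * lower x (u x) al * lower x (u x) be
    + p (x ct) * gdn g x al be.

End Geometry.

Definition u_fund : point -> vector := fun _ al => delta al ct.

(* The domain of the coordinates (t, r, theta, phi), with t ranging over It.
   The angle phi is not restricted to one period: nothing depends on it. *)
Definition rw_domain (It : R -> Prop) (k : R) (x : point) : Prop :=
  It (x ct) /\ 0 < x cr /\ 0 < 1 - k * x cr ^ 2 /\ 0 < x cth < PI.

Definition rw_gdn (a : R -> R) (k : R) : tensor2 := fun x al be =>
  match al, be with
  | ct, ct => - 1
  | cr, cr => a (x ct) ^ 2 / (1 - k * x cr ^ 2)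
  | cth, cth => a (x ct) ^ 2 * x cr ^ 2
  | cph, cph => a (x ct) ^ 2 * (x cr ^ 2 * sin (x cth) ^ 2)
  | _, _ => 0
  end.

Definition rw_gup (a : R -> R) (k : R) : tensor2 := fun x al be =>
  if coord_eq_dec al be then / rw_gdn a k x al al else 0.

Lemma rw_gdn_sym a k x al be : rw_gdn a k x al be = rw_gdn a k x be al.
Proof. now destruct al, be. Qed.

Lemma rw_gup_gdn It a k (apos : forall t, It t -> 0 < a t) x :
  rw_domain It k x -> forall al be,
  sum4 (fun s => rw_gup a k x al s * rw_gdn a k x s be) = delta al be.
Proof.
intros (Ht & Hr & Hk & Hth1 & Hth2) al be.
pose proof (apos _ Ht) as Ha.
pose proof (sin_gt_0 _ Hth1 Hth2) as Hs.
destruct al, be; unfold sum4, rw_gup, rw_gdn, delta; simpl; try ring;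
  field; repeat split; try lra; simpl in Hk; lra.
Qed.

Definition rw_metric (It : R -> Prop) (a : R -> R) (k : R)
    (apos : forall t, It t -> 0 < a t) : metric (rw_domain It k) :=
  Metric _ (rw_gdn a k) (rw_gup a k)
    (fun x _ => rw_gdn_sym a k x) (rw_gup_gdn It a k apos).

Arguments rw_metric {It a} k apos.

(* Main.v *)
Require Import Defs.
From Stdlib Require Import Reals Lra.
From Coquelicot Require Import Coquelicot.
Open Scope R_scope.

(** In a Robertson-Walker metric [R^al_{t ga t}] is [- a''/a] times the spatial
    identity, so both the tidal operator and [R_tt = - 3 a''/a] are governed by
    [a''/a].  The scalar curvature depends on [t] only, hence
    [box f'(R) = - nabla_t nabla_t f'(R) - 3 H d/dt f'(R)]: in the [tt] field
    equation the second derivatives of [f'(R)] cancel and it can be solved for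
    [a''/a].  Along an observer's curve, parallel transport of [e] reduces the
    deviation equation to a scalar equation for [ell]. *)

Lemma sum4_ext F G : (forall m, F m = G m) -> sum4 F = sum4 G.
Proof. intros E; unfold sum4; now rewrite !E. Qed.

(** * Working inside the coordinate domain *)

Section RobertsonWalker.

Context (It : R -> Prop) (a : R -> R) (k : R) (hIt : open It)
  (ha : smooth_on It a) (apos : forall t, It t -> 0 < a t).

Let U := rw_domain It k.
Let g := rw_metric k apos.

(** The conditions defining the domain are open in each coordinate, and [cph] is unconstrained. This
    is what lets formulas known only on [U] be differentiated there. *)
Lemma rw_domain_locally x m :
  U x -> locally (x m) (fun s => U (upd x m s)).
Proof.
intros (Ht & Hr & Hk & Hth1 & Hth2).
destruct m; unfold U, rw_domain, upd; simpl.
- generalize (hIt _ Ht); apply filter_imp; intros s Hs; simpl in Hk; tauto.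
- assert (Hk' : locally (x cr) (fun s => 0 < 1 - k * s ^ 2)).
  { apply (continuous_comp (fun s => 1 - k * s ^ 2) (fun y => y)
      (x cr)).
    - apply (ex_derive_continuous (fun s => 1 - k * s ^ 2)); auto_derive; trivial.
    - apply continuous_id.
    - apply open_gt, Hk. }
  generalize (filter_and _ _ (open_gt 0 _ Hr) Hk').
  apply filter_imp; intros s [H1 H2]; simpl in H2; tauto.
- generalize (filter_and _ _ (open_gt 0 _ Hth1) (open_lt PI _ Hth2)).
  apply filter_imp; intros s [H1 H2]; simpl in Hk; tauto.
- apply filter_forall; intros s; simpl in Hk; tauto.
Qed.

Lemma pd_ext_on F G m x : U x -> (forall y, U y -> F y = G y) ->
  pd m F x = pd m G x.
Proof.
intros Hx E; apply Derive_ext_loc.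
generalize (rw_domain_locally x m Hx); apply filter_imp.
intros s; apply E.
Qed.

Lemma ex_derive_scale_factor t : It t -> ex_derive a t.
Proof. intros Ht; exact (ha 1%nat 1%nat t (le_n _) Ht). Qed.

Lemma ex_derive_Derive_scale_factor t : It t -> ex_derive (Derive a) t.
Proof. intros Ht; exact (ha 2%nat 2%nat t (le_n _) Ht). Qed.

(** * Connection coefficients of the Robertson-Walker metric *)

Definition rw_christoffel (x : point) (al be ga : coord) : R :=
  let t := x ct in let r := x cr in let th := x cth in
  match al, be, ga with
  | ct, cr, cr => a t * Derive a t / (1 - k * r ^ 2)
  | ct, cth, cth => a t * Derive a t * r ^ 2
  | ct, cph, cph => a t * Derive a t * r ^ 2 * sin th ^ 2
  | cr, ct, cr | cr, cr, ct
  | cth, ct, cth | cth, cth, ct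
  | cph, ct, cph | cph, cph, ct => Derive a t / a t
  | cr, cr, cr => k * r / (1 - k * r ^ 2)
  | cr, cth, cth => - r * (1 - k * r ^ 2)
  | cr, cph, cph => - r * (1 - k * r ^ 2) * sin th ^ 2
  | cth, cr, cth | cth, cth, cr | cph, cr, cph | cph, cph, cr => / r
  | cth, cph, cph => - sin th * cos th
  | cph, cth, cph | cph, cph, cth => cos th / sin th
  | _, _, _ => 0
  end.

Definition rw_gdn_pd (m : coord) (x : point) (al be : coord) : R :=
  let t := x ct in let r := x cr in let th := x cth in
  match m, al, be with
  | ct, cr, cr => 2 * a t * Derive a t / (1 - k * r ^ 2)
  | ct, cth, cth => 2 * a t * Derive a t * r ^ 2
  | ct, cph, cph => 2 * a t * Derive a t * (r ^ 2 * sin th ^ 2)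
  | cr, cr, cr => a t ^ 2 * (2 * k * r) / (1 - k * r ^ 2) ^ 2
  | cr, cth, cth => a t ^ 2 * (2 * r)
  | cr, cph, cph => a t ^ 2 * (2 * r * sin th ^ 2)
  | cth, cph, cph => a t ^ 2 * (r ^ 2 * (2 * sin th * cos th))
  | _, _, _ => 0
  end.

Ltac compute_pd :=
  unfold pd, upd; simpl;
  first [ apply Derive_const
        | apply is_derive_unique; auto_derive;
          [ repeat split; trivial; simpl; lra | ] ].

Lemma pd_rw_gdn m x al be : U x ->
  pd m (fun y => rw_gdn a k y al be) x = rw_gdn_pd m x al be.
Proof.
intros (Ht & Hr & Hk & Hth1 & Hth2).
pose proof (ex_derive_scale_factor _ Ht) as Da.
simpl in Hk.
destruct m, al, be; unfold rw_gdn, rw_gdn_pd; compute_pd.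
(* [auto_derive] leaves eta-expanded copies of [a], which [field] would treat as different atoms. *)
all: change (fun x0 : R => a x0) with a; field; lra.
Qed.

Lemma christoffel_rw x al be ga : U x ->
  christoffel g x al be ga = rw_christoffel x al be ga.
Proof.
intros Hx; unfold christoffel, g; simpl.
assert (E : forall s, rw_gup a k x al s *
     (pd be (fun y => rw_gdn a k y s ga) x +
      pd ga (fun y => rw_gdn a k y s be) x -
      pd s (fun y => rw_gdn a k y be ga) x)
   = rw_gup a k x al s * (rw_gdn_pd be x s ga + rw_gdn_pd ga x s be
       - rw_gdn_pd s x be ga)).
{ intros s; now rewrite !pd_rw_gdn. }
rewrite (sum4_ext _ _ E).
destruct Hx as (Ht & Hr & Hk & Hth1 & Hth2).
pose proof (apos _ Ht) as Ha.
pose proof (sin_gt_0 _ Hth1 Hth2) as Hs.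
simpl in Hk.
destruct al, be, ga; unfold sum4, g, rw_gup, rw_gdn, rw_gdn_pd, rw_christoffel;
  simpl; try ring; field; repeat split; lra.
Qed.

(** * Curvature of the Robertson-Walker metric *)

Lemma riemann_rw_pd x al be ga de : U x ->
  riemann g x al be ga de =
  pd ga (fun y => rw_christoffel y al de be) x
  - pd de (fun y => rw_christoffel y al ga be) x
  + sum4 (fun s => rw_christoffel x al ga s * rw_christoffel x s de be)
  - sum4 (fun s => rw_christoffel x al s de * rw_christoffel x s ga be).
Proof.
intros Hx; unfold riemann.
(* Under a partial derivative the closed form must hold throughout [U], not only at [x]. *)
rewrite (pd_ext_on _ (fun y => rw_christoffel y al de be) ga x Hx)
  by (intros; now apply christoffel_rw).
rewrite (pd_ext_on _ (fun y => rw_christoffel y al ga be) de x Hx)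
  by (intros; now apply christoffel_rw).
unfold sum4; now rewrite !christoffel_rw.
Qed.

(** Sectional curvatures of the coordinate planes. The diagonal value 0 matches the antisymmetry of
    the Riemann tensor, so that sums may run over all pairs of indices. *)
Definition rw_sectional (x : point) (al be : coord) : R :=
  match al, be with
  | ct, ct | cr, cr | cth, cth | cph, cph => 0
  | ct, _ | _, ct => Derive_n a 2 (x ct) / a (x ct)
  | _, _ => (Derive a (x ct) ^ 2 + k) / a (x ct) ^ 2
  end.

(** The sum of squares of sine and cosine is left unreduced, so that [field] can check every entry
    without a trigonometric identity. *)
Definition rw_christoffel_pd (m : coord) (x : point) (al be ga : coord) : R :=
  let t := x ct in let r := x cr in let th := x cth in
  match m, al, be, ga with
  | ct, ct, cr, cr =>
      (Derive a t ^ 2 + a t * Derive_n a 2 t) / (1 - k * r ^ 2)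
  | ct, ct, cth, cth => (Derive a t ^ 2 + a t * Derive_n a 2 t) * r ^ 2
  | ct, ct, cph, cph =>
      (Derive a t ^ 2 + a t * Derive_n a 2 t) * r ^ 2 * sin th ^ 2
  | ct, cr, ct, cr | ct, cr, cr, ct | ct, cth, ct, cth | ct, cth, cth, ct
  | ct, cph, ct, cph | ct, cph, cph, ct =>
      (Derive_n a 2 t * a t - Derive a t ^ 2) / a t ^ 2
  | cr, ct, cr, cr => a t * Derive a t * (2 * k * r) / (1 - k * r ^ 2) ^ 2
  | cr, ct, cth, cth => a t * Derive a t * (2 * r)
  | cr, ct, cph, cph => a t * Derive a t * (2 * r) * sin th ^ 2
  | cr, cr, cr, cr => k * (1 + k * r ^ 2) / (1 - k * r ^ 2) ^ 2
  | cr, cr, cth, cth => - (1 - 3 * k * r ^ 2)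
  | cr, cr, cph, cph => - (1 - 3 * k * r ^ 2) * sin th ^ 2
  | cr, cth, cr, cth | cr, cth, cth, cr
  | cr, cph, cr, cph | cr, cph, cph, cr => - / r ^ 2
  | cth, ct, cph, cph => a t * Derive a t * r ^ 2 * (2 * sin th * cos th)
  | cth, cr, cph, cph => - r * (1 - k * r ^ 2) * (2 * sin th * cos th)
  | cth, cth, cph, cph => sin th ^ 2 - cos th ^ 2
  | cth, cph, cth, cph | cth, cph, cph, cth =>
      - (sin th ^ 2 + cos th ^ 2) / sin th ^ 2
  | _, _, _, _ => 0
  end.

Lemma pd_rw_christoffel m x al be ga : U x ->
  pd m (fun y => rw_christoffel y al be ga) x = rw_christoffel_pd m x al be ga.
Proof.
intros (Ht & Hr & Hk & Hth1 & Hth2).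
pose proof (ex_derive_scale_factor _ Ht) as Da.
pose proof (ex_derive_Derive_scale_factor _ Ht) as Da'.
pose proof (apos _ Ht) as Ha.
pose proof (sin_gt_0 _ Hth1 Hth2) as Hs.
simpl in Hk.
unfold rw_christoffel_pd, rw_christoffel; cbv zeta.
change (Derive_n a 2) with (Derive (Derive a)).
(* Naming the derivative makes it an opaque function for [auto_derive], whose differentiability is
   then the hypothesis [Da']. *)
set (b := Derive a) in *.
destruct m, al, be, ga; compute_pd.
all: change (fun x0 : R => a x0) with a; change (Derive a) with b;
  change (fun x0 : R => b x0) with b; field; repeat split; lra.
Qed.

Lemma riemann_rw_sectional x al be : U x ->
  riemann g x al be al be = rw_sectional x al be * rw_gdn a k x be be.
Proof.
intros Hx; rewrite riemann_rw_pd, !pd_rw_christoffel by trivial.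
destruct Hx as (Ht & Hr & Hk & Hth1 & Hth2).
pose proof (apos _ Ht) as Ha.
pose proof (sin_gt_0 _ Hth1 Hth2) as Hs.
assert (HC : cos (x cth) ^ 2 = 1 - sin (x cth) ^ 2).
{ pose proof (sin2_cos2 (x cth)) as E; unfold Rsqr in E; simpl; lra. }
destruct al, be;
  unfold sum4, rw_christoffel, rw_christoffel_pd, rw_sectional, rw_gdn;
  cbv zeta iota beta; try ring; field [HC]; repeat split; lra.
Qed.

(** The difference of deltas is the projection orthogonal to [u_fund]: it acts as the identity on
    spatial vectors and has trace 3. *)
Lemma riemann_rw_time x al ga : U x ->
  riemann g x al ct ga ct =
  - (Derive_n a 2 (x ct) / a (x ct)) * (delta al ga - delta al ct * delta ct ga).
Proof.
intros Hx; rewrite riemann_rw_pd, !pd_rw_christoffel by trivial.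
destruct Hx as (Ht & Hr & Hk & Hth1 & Hth2).
pose proof (apos _ Ht) as Ha.
pose proof (sin_gt_0 _ Hth1 Hth2) as Hs.
destruct al, ga; unfold sum4, rw_christoffel, rw_christoffel_pd, delta;
  cbv -[Rplus Rmult Rminus Ropp Rinv Rdiv Derive Derive_n sin cos pow IZR];
  try ring; field; repeat split; lra.
Qed.

Lemma tidal_u_fund x eta al :
  tidal g x (u_fund x) eta al = sum4 (fun ga => riemann g x al ct ga ct * eta ga).
Proof.
unfold tidal, sum4, u_fund, delta; simpl; ring.
Qed.

Lemma tidal_rw x eta al : U x -> eta ct = 0 ->
  tidal g x (u_fund x) eta al = - (Derive_n a 2 (x ct) / a (x ct)) * eta al.
Proof.
intros Hx H0; rewrite tidal_u_fund; unfold sum4.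
rewrite !riemann_rw_time by trivial.
destruct al; unfold delta; simpl; rewrite H0; ring.
Qed.

Lemma ricci_rw_time x : U x ->
  ricci g x ct ct = - 3 * (Derive_n a 2 (x ct) / a (x ct)).
Proof.
intros Hx; unfold ricci, sum4; rewrite !riemann_rw_time by trivial.
unfold delta; simpl; ring.
Qed.

Definition rw_scalar (t : R) : R :=
  6 * (Derive_n a 2 t / a t + (Derive a t ^ 2 + k) / a t ^ 2).

(** The metric is diagonal, so the inverse metric cancels the factor [rw_gdn] in
    [riemann_rw_sectional] and the scalar curvature is the sum of the sectional curvatures over
    ordered pairs: six pairs contain [ct] and six are spatial. *)
Lemma scalar_curvature_rw x : U x ->
  scalar_curvature g x = rw_scalar (x ct).
Proof.
intros Hx.
assert (E : scalar_curvature g x =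
  sum4 (fun al => sum4 (fun e => rw_sectional x e al))).
{ unfold scalar_curvature; apply sum4_ext; intros al.
  transitivity (/ rw_gdn a k x al al * ricci g x al al).
  - destruct al; unfold sum4, g; simpl; unfold rw_gup; simpl; ring.
  - unfold ricci.
    rewrite (sum4_ext (fun e => riemann g x e al e al) _
      (fun e => riemann_rw_sectional x e al Hx)).
    destruct Hx as (Ht & Hr & Hk & Hth1 & Hth2).
    pose proof (apos _ Ht) as Ha.
    pose proof (sin_gt_0 _ Hth1 Hth2) as Hs.
    simpl in Hk.
    destruct al; unfold sum4, rw_gdn; field; repeat split; simpl; lra. }
rewrite E; unfold sum4, rw_sectional, rw_scalar; ring.
Qed.

(** The third derivative of [a] enters here, through the term in [Derive_n a 2]. *)
Lemma ex_derive_rw_scalar t : It t -> ex_derive rw_scalar t.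
Proof.
intros Ht; unfold rw_scalar.
pose proof (ex_derive_scale_factor _ Ht) as Da.
pose proof (ex_derive_Derive_scale_factor _ Ht) as Da'.
pose proof (ha 3%nat 3%nat t (le_n _) Ht) as Da''.
pose proof (apos _ Ht) as Ha.
change (ex_derive (Derive_n a 2) t) in Da''.
set (b := Derive a) in *; set (d := Derive_n a 2) in *.
auto_derive; repeat split; trivial; simpl; nra.
Qed.

(** * Functions of time and the time-time field equation *)

Lemma pd_time_function F phi m x : U x ->
  (forall y, U y -> F y = phi (y ct)) ->
  pd m F x = delta m ct * Derive phi (x ct).
Proof.
intros Hx E; rewrite (pd_ext_on F (fun y => phi (y ct)) m x Hx E).
destruct m; unfold pd, upd, delta; simpl;
  [ rewrite Rmult_1_l; reflexivity | rewrite Derive_const; ring .. ].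
Qed.

(** A spatial diagonal entry of the Hessian is only the connection term, - H g_mm phi', so each of
    the three spatial directions contributes - H phi' to the trace. The [ct] entry stays unevaluated
    because it cancels in the field equation. *)
Lemma box_time_function F phi x : U x ->
  (forall y, U y -> F y = phi (y ct)) ->
  box g F x =
  - hessian g F x ct ct - 3 * (Derive a (x ct) / a (x ct)) * Derive phi (x ct).
Proof.
intros Hx E.
assert (Hh : forall m, m <> ct -> hessian g F x m m =
    - rw_christoffel x ct m m * Derive phi (x ct)).
{ intros m Hm; unfold hessian, nabla_covector, sum4.
  (* The spatial first derivative vanishes on all of [U], so it is itself a function of time, namely
     0. *)
  rewrite (pd_time_function (fun y => pd m F y) (fun _ => 0) m x Hx).
  2: { intros y Hy; rewrite (pd_time_function F phi m y Hy E).
       destruct m; [easy | unfold delta; simpl; ring ..]. }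
  rewrite Derive_const, !(pd_time_function F phi _ x Hx E), !christoffel_rw
    by trivial.
  unfold delta; simpl; ring. }
unfold box.
transitivity (sum4 (fun s => / rw_gdn a k x s s * hessian g F x s s)).
{ apply sum4_ext; intros []; unfold sum4, g; simpl; unfold rw_gup; simpl; ring. }
unfold sum4; rewrite (Hh cr), (Hh cth), (Hh cph) by discriminate.
destruct Hx as (Ht & Hr & Hk & Hth1 & Hth2).
pose proof (apos _ Ht) as Ha.
pose proof (sin_gt_0 _ Hth1 Hth2) as Hs.
simpl in Hk.
unfold rw_gdn, rw_christoffel; field; repeat split; simpl; lra.
Qed.

(** Since T_tt = rho, the pressure drops out, and the time-time equation reads - 3 f'(R) a''/a +
    f(R)/2 + 3 H f''(R) dR/dt = kappa rho, which is linear in a''/a. *)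
Lemma raychaudhuri_rw (f rho p : R -> R) (kappa : R) x : U x ->
  ex_derive (Derive f) (scalar_curvature g x) ->
  Derive f (scalar_curvature g x) <> 0 ->
  fR_field_equations g f kappa (perfect_fluid g u_fund rho p) ->
  Derive_n a 2 (x ct) / a (x ct) =
  1 / Derive f (scalar_curvature g x) *
  (f (scalar_curvature g x) / 6
   + Derive a (x ct) / a (x ct) * Derive_n f 2 (scalar_curvature g x)
     * pd ct (scalar_curvature g) x
   - kappa * rho (x ct) / 3).
Proof.
intros Hx Df Hf Hfield.
pose proof (Hfield x Hx ct ct) as E; simpl in E.
rewrite (box_time_function _ (fun t => Derive f (rw_scalar t)) x Hx) in E
  by (intros y Hy; now rewrite scalar_curvature_rw).
rewrite (pd_time_function (scalar_curvature g) rw_scalar ct x Hx)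
  by exact scalar_curvature_rw.
(* The chain rule turns the time derivative of f'(R) into f''(R) dR/dt. *)
rewrite (Derive_comp (Derive f) rw_scalar), ricci_rw_time in E
  by (trivial; try apply ex_derive_rw_scalar, Hx;
      now rewrite <- (scalar_curvature_rw x Hx)).
set (q := Derive_n a 2 (x ct) / a (x ct)) in *.
set (h := Derive a (x ct) / a (x ct)) in *.
unfold perfect_fluid, lower, sum4, u_fund, delta in E; simpl in E.
rewrite <- (scalar_curvature_rw x Hx) in E.
change (Derive_n f 2) with (Derive (Derive f)).
unfold delta; simpl; field_simplify_eq; [lra | trivial].
Qed.

End RobertsonWalker.

(** * Deviation along a curve with a parallel direction *)

Lemma cov_along_scal U (g : metric U) c (ell : R -> R) (e : R -> vector) s al :
  ex_derive ell s -> ex_derive (fun z => e z al) s ->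
  cov_along g c (fun z m => ell z * e z m) s al =
  Derive ell s * e s al + ell s * cov_along g c e s al.
Proof.
intros Dl De; unfold cov_along.
rewrite Derive_mult by trivial; unfold sum4; ring.
Qed.

(** As [e] is parallel, the Leibniz rule applied twice gives ell'' e for the second covariant
    derivative of ell e. Comparing components with - q ell e leaves a scalar equation wherever [e]
    is nonzero. *)
Lemma geodesic_deviation_scalar U (g : metric U) (u : point -> vector)
  (S : R -> Prop) c (ell : R -> R) (e : R -> vector) (q : R) s :
  open S -> diff_on 2 S ell -> (forall al, diff_on 1 S (fun z => e z al)) ->
  (forall z, S z -> forall al, cov_along g c e z al = 0) ->
  deviation_vector g S u c (fun z al => ell z * e z al) ->
  S s -> inner g (c s) (e s) (e s) <> 0 ->
  (forall al, tidal g (c s) (u (c s)) (fun m => ell s * e s m) al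
     = q * (ell s * e s al)) ->
  Derive_n ell 2 s = - q * ell s.
Proof.
intros HS Dl De Hpar Hdev Hs Hne Htid.
assert (Dl1 : forall z, S z -> ex_derive ell z)
  by (intros z Hz; exact (Dl 1%nat z (le_S _ _ (le_n _)) Hz)).
assert (De1 : forall z al, S z -> ex_derive (fun z => e z al) z)
  by (intros z al Hz; exact (De al 1%nat z (le_n _) Hz)).
assert (H1 : forall z al, S z ->
  cov_along g c (fun z m => ell z * e z m) z al = Derive ell z * e z al).
{ intros z al Hz; rewrite cov_along_scal, Hpar by auto; ring. }
assert (H2 : forall al, Derive_n ell 2 s * e s al = - q * ell s * e s al).
{ intros al; transitivity (- (q * (ell s * e s al))); [| ring].
  rewrite <- Htid, <- (Hdev s Hs al).
  transitivity (cov_along g c (fun z m => Derive ell z * e z m) s al).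
  - rewrite cov_along_scal, Hpar by (auto; exact (Dl 2%nat s (le_n _) Hs)).
    change (Derive_n ell 2) with (Derive (Derive ell)); ring.
  - unfold cov_along at 1 2.
    (* The outer derivative sees the inner field near [s], where [H1] applies because [S] is
       open. *)
    rewrite (Derive_ext_loc (fun z => cov_along g c _ z al)
      (fun z => Derive ell z * e z al)).
    + unfold sum4; now rewrite !H1.
    + generalize (HS s Hs); apply filter_imp; auto. }
(* If ell'' + q ell were nonzero, [H2] would make every component of [e s] vanish, against its
   nonzero norm. *)
destruct (Req_dec (Derive_n ell 2 s) (- q * ell s)) as [E | E]; trivial.
exfalso; apply Hne.
assert (H0 : forall al, e s al = 0).
{ intros al; apply (Rmult_eq_reg_l (Derive_n ell 2 s - - q * ell s)); [| lra].
  rewrite Rmult_minus_distr_r, H2; ring. }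
unfold inner, sum4; rewrite !H0; ring.
Qed.

Theorem mainTheorem3 (kappa k : R) (It J : R -> Prop) (a f rho p : R -> R)
  (hkappa : 0 < kappa)
  (hk : k = -1 \/ k = 0 \/ k = 1)
  (hIt : open It) (ha : smooth_on It a) (apos : forall t, It t -> 0 < a t)
  (hJ : open J) (hf : smooth_on J f)
  (hR : forall x, rw_domain It k x -> J (scalar_curvature (rw_metric k apos) x))
  (hf' : forall x, rw_domain It k x ->
    Derive f (scalar_curvature (rw_metric k apos) x) <> 0)
  (hfield : fR_field_equations (rw_metric k apos) f kappa
    (perfect_fluid (rw_metric k apos) u_fund rho p)) :
  let g := rw_metric k apos in
  let Rs := scalar_curvature g in
  let H := fun t => Derive a t / a t in
  let K := fun x : point =>
    1 / (2 * Derive f (Rs x)) *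
    (2 * kappa * rho (x ct) / 3 - f (Rs x) / 3
     - 2 * H (x ct) * Derive_n f 2 (Rs x) * pd ct Rs x) in
  (forall x, rw_domain It k x -> forall eta : vector,
     inner g x eta (u_fund x) = 0 ->
     forall al, tidal g x (u_fund x) eta al = K x * eta al)
  /\
  (forall (S : R -> Prop) (c : R -> point) (ell : R -> R) (e : R -> vector),
     open S ->
     integral_curve (U := rw_domain It k) S u_fund c ->
     diff_on 2 S ell ->
     (forall al, diff_on 1 S (fun s => e s al)) ->
     (forall s, S s -> inner g (c s) (e s) (e s) = 1) ->
     (forall s, S s -> inner g (c s) (e s) (u_fund (c s)) = 0) ->
     (forall s, S s -> forall al, cov_along g c e s al = 0) ->
     deviation_vector g S u_fund c (fun s al => ell s * e s al) ->
     forall s, S s -> Derive_n ell 2 s = - K (c s) * ell s)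
  /\
  (forall x, rw_domain It k x ->
     Derive_n a 2 (x ct) / a (x ct) =
     1 / Derive f (Rs x) *
     (f (Rs x) / 6 + H (x ct) * Derive_n f 2 (Rs x) * pd ct Rs x
      - kappa * rho (x ct) / 3)).
Proof.
intros g Rs H K.
(* All three conclusions rest on this identity: by the time-time equation, [K] is - a''/a, the
   eigenvalue of the tidal operator on spatial vectors. *)
assert (HK : forall x, rw_domain It k x ->
  Derive_n a 2 (x ct) / a (x ct) = - K x).
{ intros x Hx.
  rewrite (raychaudhuri_rw It a k hIt ha apos f rho p kappa x Hx); auto.
  - unfold K, H, Rs, g; field; split; auto.
    apply Rgt_not_eq, apos, Hx.
  - exact (hf 2%nat 2%nat _ (le_n _) (hR x Hx)). }
(* The inner product with [u_fund] is minus the time component. *)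
assert (H0 : forall x eta, inner g x eta (u_fund x) = 0 -> eta ct = 0).
{ intros x eta; unfold inner, sum4, u_fund, delta; simpl; lra. }
assert (Htid : forall x, rw_domain It k x -> forall eta,
  inner g x eta (u_fund x) = 0 ->
  forall al, tidal g x (u_fund x) eta al = K x * eta al).
{ intros x Hx eta Heta al; unfold g; rewrite tidal_rw by eauto.
  rewrite HK by trivial; ring. }
split; [exact Htid | split].
- intros S c ell e HS Hc Dl De Hunit Horth Hpar Hdev s Hs.
  (* Here q is [K (c s)]: the tidal identity applies to ell e, which is orthogonal to [u_fund]
     because [e] is. *)
  apply (geodesic_deviation_scalar _ g u_fund S c ell e); auto.
  + rewrite Hunit by trivial; lra.
  + apply Htid; [apply (Hc s Hs) |].
    transitivity (ell s * inner g (c s) (e s) (u_fund (c s))).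
    * unfold inner, sum4; ring.
    * rewrite Horth by trivial; ring.
- intros x Hx; rewrite HK by trivial.
  unfold K; field; auto.
Qed.
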